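(* For every $Q\in\mathbb R^n$ there exists a stochastic stationary policy $\mu_Q$ such that \[ F(Q)-Q^\star=A_{\mu_Q}(Q-Q^\star). \] Consequently, with $e:=Q-Q^\star$, \[ F(Q)-Q=(A_{\mu_Q}-I)e . \] In particular, this applies with $Q=Q_k$ for every iterate $Q_k$ of standard Q-value iteration $Q_{k+1}=F(Q_k)$ and for every iterate of deflated Q-value iteration $Q_{k+1}=F(Q_k)+\frac{\gamma}{1-\gamma}\big(\frac1n\mathbf 1^\top(F(Q_k)-Q_k)\big)\mathbf 1$.
   Context: Setting: a finite discounted Markov decision process with finite nonempty state space $\mathcal S$, finite nonempty action space $\mathcal A$, transition probabilities $P(s'\mid s,a)$, real rewards $r(s,a,s')$, discount factor $\gamma\in(0,1)$, and expected reward $R(s,a):=\sum_{s'}P(s'\mid s,a)r(s,a,s')$. Put $n:=|\mathcal S||\mathcal A|$; vectors in $\mathbb R^n$ are indexed by pairs $(s,a)$. The Bellman optimality operator $F:\mathbb R^n\to\mathbb R^n$ is $(FQ)(s,a):=R(s,a)+\gamma\sum_{s'}P(s'\mid s,a)\max_{a'}Q(s',a')$, and $Q^\star$ is its unique fixed point (the optimal Q-function). $\mathbf 1$ is the all-ones vector. A stochastic stationary policy is a map $\mu$ assigning to each $s\in\mathcal S$ a probability distribution $\mu(\cdot\mid s)$ on $\mathcal A$. $A_\mu\in\mathbb R^{n\times n}$ has entries $A_\mu((s,a),(s',a')):=\gamma P(s'\mid s,a)\,\mu(a'\mid s')$. *)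

(* Defs.v *)
From HB Require Import structures.
From mathcomp Require Import all_boot all_order all_algebra.
From mathcomp Require Import all_classical all_reals all_analysis.

Set Implicit Arguments.
Unset Strict Implicit.
Unset Printing Implicit Defensive.

Import Order.TTheory GRing.Theory Num.Theory.
Import numFieldNormedType.Exports.

Local Open Scope classical_set_scope.
Local Open Scope ring_scope.

(* [trans M s a s'] is P(s' | s, a). *)
Record mdp (R : realType) (S A : finType) := Mdp {
  trans : S -> A -> S -> R;
  reward : S -> A -> S -> R;
  discount : R;
  states_gt0 : (0 < #|S|)%N;
  actions_gt0 : (0 < #|A|)%N;
  trans_ge0 : forall s a s', 0 <= trans s a s';
  trans_sum1 : forall s a, \sum_s' trans s a s' = 1;
  discount_gt0 : 0 < discount;
  discount_lt1 : discount < 1 }.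

(* [mu s a] is mu(a | s). *)
Record policy (R : realType) (S A : finType) := Policy {
  policy_prob :> S -> A -> R;
  policy_ge0 : forall s a, 0 <= policy_prob s a;
  policy_sum1 : forall s, \sum_a policy_prob s a = 1 }.

(* The number n = |S||A| of state-action pairs ([card_prod]).  Coordinates of
   vectors and matrices correspond to pairs through [enum_rank] and its inverse
   [enum_val]. *)
Notation nsa S A := #|{: S * A}|.

Definition entry (R : realType) (S A : finType) (Q : 'cV[R]_(nsa S A))
    (s : S) (a : A) : R :=
  Q (enum_rank (s, a)) 0.

Section MDP.
Context {R : realType} {S A : finType}.
Variable M : mdp R S A.

Local Notation vec := 'cV[R]_(nsa S A).
Local Notation mat := 'M[R]_(nsa S A).

Implicit Types Q : vec.

Definition expected_reward (s : S) (a : A) : R :=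
  \sum_s' trans M s a s' * reward M s a s'.

(* An arbitrary action, used only as the neutral starting point of the maximum
   in [max_action]. *)
Definition some_action : A := enum_val (Ordinal (actions_gt0 M)).

Definition max_action Q (s : S) : R :=
  \big[Num.max/entry Q s some_action]_(a : A) entry Q s a.

Definition bellman Q : vec :=
  \col_i let: (s, a) := enum_val i in
    expected_reward s a
    + discount M * \sum_s' trans M s a s' * max_action Q s'.

(* The default value 0 is never used: see [bellman_Qstar] and [Qstar_unique]. *)
Definition Qstar : vec := xget 0 [set Q | bellman Q = Q].

Definition policy_mx (mu : policy R S A) : mat :=
  \matrix_(i, j) let: (s, a) := enum_val i in let: (s', a') := enum_val j in
    discount M * trans M s a s' * mu s' a'.

Definition ones : vec := const_mx 1.

Definition deflated_step Q : vec :=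
  bellman Q
  + (discount M / (1 - discount M)
     * ((nsa S A)%:R^-1 * (ones^T *m (bellman Q - Q)) 0 0)) *: ones.

Definition is_QVI (Qk : nat -> vec) : Prop :=
  forall k, Qk k.+1 = bellman (Qk k).

Definition is_deflated_QVI (Qk : nat -> vec) : Prop :=
  forall k, Qk k.+1 = deflated_step (Qk k).

Lemma le_max_action Q s a : entry Q s a <= max_action Q s.
Proof. exact: le_bigmax. Qed.

Lemma max_action_attained Q s : exists a, max_action Q s = entry Q s a.
Proof.
rewrite /max_action; elim/big_ind: _ => [|x y [a ->] [b ->]|a _].
- by exists some_action.
- by case: (leP (entry Q s a) (entry Q s b)) => _; [exists b|exists a].
- by exists a.
Qed.

Lemma entry_dist Q Q' s a : `|entry Q s a - entry Q' s a| <= `|Q - Q'|.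
Proof.
rewrite [leRHS]/Num.Def.normr /= mx_normrE; apply: le_trans (le_bigmax _ _ (enum_rank (s, a), 0)).
by rewrite /= !mxE.
Qed.

Lemma max_action_dist Q Q' s :
  `|max_action Q s - max_action Q' s| <= `|Q - Q'|.
Proof.
wlog le_QQ' : Q Q' / max_action Q' s <= max_action Q s.
  move=> W; have [/W//|/ltW/W] := leP (max_action Q' s) (max_action Q s).
  by rewrite distrC [in leRHS]distrC.
rewrite ger0_norm ?subr_ge0//.
have [a Qa] := max_action_attained Q s.
apply: le_trans (entry_dist Q Q' s a).
by rewrite (le_trans _ (ler_norm _))// Qa lerB// le_max_action.
Qed.

Lemma bellman_dist Q Q' :
  `|bellman Q - bellman Q'| <= discount M * `|Q - Q'|.
Proof.
have g0 := ltW (discount_gt0 M).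
rewrite [leLHS]/Num.Def.normr /= mx_normrE; apply: bigmax_le => [|[i j] _ /=].
  by rewrite mulr_ge0.
rewrite !mxE; case: (enum_val i) => s a.
rewrite opprD addrACA subrr add0r -mulrBr normrM ger0_norm// ler_wpM2l//.
rewrite -sumrB (le_trans (ler_norm_sum _ _ _))//.
rewrite -[leRHS]mul1r -(trans_sum1 M s a) mulr_suml ler_sum// => s' _.
rewrite -mulrBr normrM ger0_norm ?trans_ge0// ler_wpM2l ?trans_ge0//.
exact: max_action_dist.
Qed.

Lemma bellman_fixed_unique Q Q' : bellman Q = Q -> bellman Q' = Q' -> Q = Q'.
Proof.
move=> FQ FQ'; apply/subr0_eq/normr0_eq0/eqP; apply: contraT => QQ'.
have := bellman_dist Q Q'; rewrite FQ FQ' -[leLHS]mul1r.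
by rewrite ler_pM2r ?lt0r ?QQ' ?normr_ge0// leNgt discount_lt1.
Qed.

Lemma bellman_fixed_exists : exists Q, bellman Q = Q.
Proof.
have homF : set_fun [set: vec] [set: vec] bellman by [].
pose F := HB.pack_for {fun [set: vec] >-> [set: vec]} bellman
  (isFun.Build _ _ _ _ bellman homF).
have ctr : is_contraction F.
  exists (NngNum (ltW (discount_gt0 M))); split; first exact: discount_lt1.
  by move=> [Q Q'] _ /=; exact: bellman_dist.
pose V : completeNormedModType R := HB.pack_for (completeNormedModType R) vec
  (Complete.on vec).
have [|Q _ FQ] := @banach_fixed_point R V setT F ctr closedT.
  by exists 0.
by exists Q.
Qed.

Lemma bellman_Qstar : bellman Qstar = Qstar.
Proof. exact: (xgetPex 0 bellman_fixed_exists). Qed.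

Lemma Qstar_unique Q : bellman Q = Q -> Q = Qstar.
Proof. by move=> FQ; exact: bellman_fixed_unique FQ bellman_Qstar. Qed.

End MDP.

(* Main.v *)
Require Import Defs.
From mathcomp Require Import all_boot all_order all_algebra.
From mathcomp Require Import all_classical all_reals all_analysis.
From mathcomp Require Import ring.

Set Implicit Arguments.
Unset Strict Implicit.
Unset Printing Implicit Defensive.

Import Order.TTheory GRing.Theory Num.Theory.
Local Open Scope ring_scope.

(** The rewards cancel in [F(Q) - F(Q')], which leaves
    [gamma * P (max Q - max Q')], so it suffices to write, at each state [s],
    the difference of the two maxima as an average of the differences
    [d a := Q(s,a) - Q'(s,a)] over the actions.  If [a] is greedy for [Q] and
    [b] is greedy for [Q'] at [s], then
      [d b <= max Q(s,.) - max Q'(s,.) <= d a],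
    so the middle number is a convex combination of [d a] and [d b]
    ([max_action_diff_average]); its two weights are the distribution of the
    policy at [s].  This compares any two vectors [Q] and [Q']
    ([bellman_diff_policy]); for [Q' := Q*], the fixed point of [F], it is the
    first formula, and subtracting [e = Q - Q*] from that gives the second.  The
    iterates of either scheme are particular vectors [Q]. *)

Lemma convex_weight (R : realFieldType) (lo x hi : R) : lo <= x -> x <= hi ->
  exists t, [/\ 0 <= t, t <= 1 & x = t * hi + (1 - t) * lo].
Proof.
move=> lox xhi; have [hilo|hilo] := eqVneq hi lo.
  by exists 1; split=> //; apply/le_anti; rewrite subrr mul0r addr0 mul1r xhi hilo.
have d_gt0 : 0 < hi - lo by rewrite subr_gt0 lt_neqAle eq_sym hilo (le_trans lox).
exists ((x - lo) / (hi - lo)); split.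
- by rewrite divr_ge0 ?subr_ge0// (le_trans lox).
- by rewrite ler_pdivrMr// mul1r lerB.
- by field; rewrite gt_eqF.
Qed.

Section BellmanDifference.
Context {R : realType} {S A : finType} (M : mdp R S A).
Implicit Types Q : 'cV[R]_(nsa S A).

(** The distribution sits on an action greedy for [Q] and one greedy for [Q'],
    whose differences bound the difference of the maxima from above and from
    below. *)
Lemma max_action_diff_average Q Q' (s : S) :
  exists p : A -> R, [/\ forall a, 0 <= p a, \sum_a p a = 1 &
    max_action M Q s - max_action M Q' s
    = \sum_a p a * (entry Q s a - entry Q' s a)].
Proof.
have [a Qa] := max_action_attained M Q s.
have [b Q'b] := max_action_attained M Q' s.
have [||t [t0 t1 ->]] := @convex_weight R (entry Q s b - entry Q' s b)
    (max_action M Q s - max_action M Q' s) (entry Q s a - entry Q' s a).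
- by rewrite Q'b lerB// le_max_action.
- by rewrite Qa lerB// le_max_action.
have dirac c (f : A -> R) : \sum_i (i == c)%:R * f i = f c.
  by rewrite (bigD1 c)//= eqxx mul1r big1 ?addr0// => i /negPf ->; rewrite mul0r.
(* [a] and [b] may coincide, so the two point masses are added. *)
have avg f : \sum_i (t * (i == a)%:R + (1 - t) * (i == b)%:R) * f i
    = t * f a + (1 - t) * f b.
  under eq_bigr do rewrite mulrDl -!mulrA.
  by rewrite big_split -!mulr_sumr !dirac.
exists (fun i => t * (i == a)%:R + (1 - t) * (i == b)%:R); split.
- by move=> i; rewrite addr_ge0 ?mulr_ge0 ?subr_ge0.
- have := avg (fun=> 1); under eq_bigr do rewrite mulr1.
  by move=> ->; rewrite !mulr1 addrC subrK.
- by rewrite avg.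
Qed.

Lemma policy_mxE (mu : policy R S A) (v : 'cV[R]_(nsa S A)) (s : S) (a : A) :
  entry (policy_mx M mu *m v) s a
  = discount M * \sum_s' trans M s a s' * \sum_a' mu s' a' * entry v s' a'.
Proof.
rewrite /entry mxE (reindex enum_rank) /=; last first.
  by apply: onW_bij; exact: enum_rank_bij.
under eq_bigr do rewrite mxE !enum_rankK.
under [in RHS]eq_bigr do rewrite mulr_sumr.
rewrite pair_big mulr_sumr; apply: eq_bigr => -[s' a'] _ /=.
by rewrite !mulrA.
Qed.

(** The distributions found at the individual states form one policy, because
    the difference of the maxima at [s'] does not depend on the pair [(s, a)]
    from which [s'] is reached. *)
Lemma bellman_diff_policy Q Q' :
  exists mu : policy R S A,
    bellman M Q - bellman M Q' = policy_mx M mu *m (Q - Q').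
Proof.
have [p pP] := choice (max_action_diff_average Q Q').
have p0 s a : 0 <= p s a by have [] := pP s.
have p1 s : \sum_a p s a = 1 by have [] := pP s.
exists (Policy p0 p1); apply/colP => i.
rewrite -[i]enum_valK; case: (enum_val i) => s a.
rewrite -[RHS]/(entry _ s a) policy_mxE !mxE enum_rankK.
rewrite opprD addrACA subrr add0r -mulrBr -sumrB; congr (_ * _).
apply: eq_bigr => s' _; rewrite -mulrBr; congr (_ * _).
by have [_ _ ->] := pP s'; apply: eq_bigr => a' _; rewrite /entry !mxE.
Qed.

End BellmanDifference.

Theorem lemma4 (R : realType) (S A : finType) (M : mdp R S A) :
  (forall Q : 'cV[R]_(nsa S A), exists mu : policy R S A,
      bellman M Q - Qstar M = policy_mx M mu *m (Q - Qstar M)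
      /\ (let e := Q - Qstar M in
          bellman M Q - Q = (policy_mx M mu - 1%:M) *m e))
  /\ (forall Qk : nat -> 'cV[R]_(nsa S A), is_QVI M Qk ->
      forall k, exists mu : policy R S A,
        bellman M (Qk k) - Qstar M = policy_mx M mu *m (Qk k - Qstar M)
        /\ (let e := Qk k - Qstar M in
            bellman M (Qk k) - Qk k = (policy_mx M mu - 1%:M) *m e))
  /\ (forall Qk : nat -> 'cV[R]_(nsa S A), is_deflated_QVI M Qk ->
      forall k, exists mu : policy R S A,
        bellman M (Qk k) - Qstar M = policy_mx M mu *m (Qk k - Qstar M)
        /\ (let e := Qk k - Qstar M in
            bellman M (Qk k) - Qk k = (policy_mx M mu - 1%:M) *m e)).
Proof.
have all_Q Q : exists mu : policy R S A,
    bellman M Q - Qstar M = policy_mx M mu *m (Q - Qstar M)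
    /\ (let e := Q - Qstar M in
        bellman M Q - Q = (policy_mx M mu - 1%:M) *m e).
  have [mu] := bellman_diff_policy M Q (Qstar M).
  rewrite bellman_Qstar => muQ; exists mu; split=> //=.
  by rewrite mulmxBl mul1mx -muQ opprB addrA subrK.
by split=> //; split=> Qk _ k; exact: all_Q.
Qed.
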